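(* Let $E_1,E_2$ be two trivial vector bundles (both real or both complex) over a smooth manifold $X$, with connections $\nabla_1,\nabla_2$ ($\mathbb{C}$-linear in the complex case), and let $\nabla$ be a connection on $E=E_1\oplus E_2$ ($\mathbb{C}$-linear in the complex case) extending $\nabla_1$ and $\nabla_2$, i.e. $\Pi_1\nabla\Pi_1=\nabla_1$ and $\Pi_2\nabla\Pi_2=\nabla_2$, where $\Pi_1,\Pi_2$ are the projectors in $E$ on $E_1$, respectively $E_2$. Fix trivializations of $E_1$ and $E_2$, write $\nabla_1=d+\omega_1$, $\nabla_2=d+\omega_2$, and, in the induced trivialization of $E$, $\nabla=d+\omega$ with $$\omega=\begin{bmatrix}\omega_1&A\\ B&\omega_2\end{bmatrix},$$ where $A$, $B$ are matrix-valued $1$-forms of suitable dimensions. Let $R$ be the curvature of $\nabla$ and $R_{ij}=\Pi_iR\,\Pi_j$ for $i,j\in\{1,2\}$. If $R_{12}=0$ and $R_{21}=0$, then in the real case $$\mathrm{cs}(\omega)=\mathrm{cs}(\omega_1)+\mathrm{cs}(\omega_2),$$ while in the complex case $\mathrm{cs}_{\mathbb{C}}(\omega)=\mathrm{cs}_{\mathbb{C}}(\omega_1)+\mathrm{cs}_{\mathbb{C}}(\omega_2)$.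
   Context: Matrix-valued forms are multiplied by combining the matrix product with the wedge product. For a real matrix-valued $1$-form $\omega\in\Lambda^1(X,\mathfrak{gl}_r(\mathbb{R}))$, the Chern--Simons form is $\mathrm{cs}(\omega)=-\frac{1}{16\pi^2}\mathrm{tr}\left(\omega\,d\omega+\frac23\omega^3\right)\in\Lambda^3(X)$. For a complex matrix-valued $1$-form, $\mathrm{cs}_{\mathbb{C}}(\omega)=-\frac{1}{8\pi^2}\mathrm{tr}_{\mathbb{C}}\left(\omega\,d\omega+\frac23\omega^3\right)\in\Lambda^3(X)\otimes_{\mathbb{R}}\mathbb{C}$, where $\mathrm{tr}_{\mathbb{C}}$ is the complex trace. The curvature of $d+\omega$ is $\Omega=d\omega+\omega^2$. *)

(* Defs.v *)
From HB Require Import structures.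
From mathcomp Require Import all_boot all_order all_algebra all_fingroup.
From mathcomp Require Import all_classical all_reals all_analysis.
From mathcomp Require Import complex.
Set Implicit Arguments.
Unset Strict Implicit.
Unset Printing Implicit Defensive.
Import Order.TTheory GRing.Theory Num.Theory.
Import numFieldNormedType.Exports.
Local Open Scope classical_set_scope.
Local Open Scope ring_scope.
Local Open Scope complex_scope.

(* f is C^k on the open set U.  The domains used below are 'rV[R]_n, where     *)
(* f is C^(k+1) iff it is differentiable and all its directional derivatives   *)
(* are C^k.                                                                    *)
Fixpoint Ck (R : realType) (V W : normedModType R) (k : nat) (U : set V)
    (f : V -> W) : Prop :=
  match k with
  | 0%N => forall y, U y -> {for y, continuous f}
  | k'.+1 => (forall y, U y -> differentiable f y) /\
             (forall v : V, Ck k' U (fun y => 'D_v f y : W))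
  end.

Definition smooth_on (R : realType) (V W : normedModType R) (U : set V)
    (f : V -> W) : Prop := forall k, Ck k U f.

(* The values of cfun outside cdom, and of cinv outside cfun @` cdom, carry no *)
(* information.                                                                *)
Record chart (R : realType) (n : nat) (X : topologicalType) := Chart {
  cdom : set X;
  cfun : X -> 'rV[R]_n;
  cinv : 'rV[R]_n -> X;
  cdom_open : open cdom;
  ccod_open : open (cfun @` cdom);
  cfunK : forall x, cdom x -> cinv (cfun x) = x;
  cfun_continuous : {within cdom, continuous cfun};
  cinv_continuous : {within cfun @` cdom, continuous cinv} }.

(* A smooth manifold of dimension n without boundary.  That the atlas covers   *)
(* is witnessed by a choice pchart x of a chart around each point x.           *)
Record manifold (R : realType) (n : nat) := Manifold {
  mspace :> topologicalType;
  mhausdorff : hausdorff_space mspace;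
  msecond_countable : @second_countable mspace;
  atlas : set (chart R n mspace);
  pchart : mspace -> chart R n mspace;
  pchart_atlas : forall x, atlas (pchart x);
  pchart_dom : forall x, cdom (pchart x) x;
  transition_smooth : forall c c', atlas c -> atlas c' ->
    smooth_on (cfun c @` (cdom c `&` cdom c')) (cfun c' \o cinv c) }.

Section Forms.
Context {R : realType} {n : nat} (X : manifold R n).

(* The tangent space at x is represented by 'rV[R]_n through the coordinates   *)
(* of the preferred chart pchart x.  A V-valued k-form assigns to each x a     *)
(* V-valued function of k tangent vectors at x; the multilinearity,            *)
(* antisymmetry and smoothness requirements are is_form and is_formC below.    *)
Definition dform (V : Type) (k : nat) : Type := X -> ('I_k -> 'rV[R]_n) -> V.

Definition form0 (V : Type) (f : X -> V) : dform V 0 := fun x _ => f x.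

(* The expression of a form in the chart c: its pullback by cinv c.  The       *)
(* vectors w j, given in the coordinates of c, are moved to those of the       *)
(* preferred chart by the differential of the transition map.                  *)
Definition local (V : Type) (k : nat) (c : chart R n X) (a : dform V k)
    (y : 'rV[R]_n) (w : 'I_k -> 'rV[R]_n) : V :=
  a (cinv c y)
    (fun j => 'D_(w j) (cfun (pchart (cinv c y)) \o cinv c) y).

Definition multilinear_form (k : nat) (f : ('I_k -> 'rV[R]_n) -> R) : Prop :=
  forall (v : 'I_k -> 'rV[R]_n) (i : 'I_k) (t : R) (u w : 'rV[R]_n),
    f (dfwith v i (t *: u + w)) = t * f (dfwith v i u) + f (dfwith v i w).

Definition alternating_form (k : nat) (f : ('I_k -> 'rV[R]_n) -> R) : Prop :=
  forall (v : 'I_k -> 'rV[R]_n) (i j : 'I_k), i != j -> v i = v j -> f v = 0.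

Definition is_form (k : nat) (a : dform R k) : Prop :=
  [/\ forall x, multilinear_form (a x),
      forall x, alternating_form (a x) &
      forall c, atlas c -> forall w : 'I_k -> 'rV[R]_n,
        smooth_on (cfun c @` cdom c) (fun y => local c a y w : R^o)].

(* Complex-valued forms are the elements of Lambda^k(X) (x)_R C.               *)
Definition is_formC (k : nat) (a : dform R[i] k) : Prop :=
  is_form (fun x v => complex.Re (a x v)) /\
  is_form (fun x v => complex.Im (a x v)).

(* Exterior derivative at x, computed in the coordinates of pchart x, with the *)
(* v i extended to constant vector fields there.                               *)
Definition extd (k : nat) (a : dform R k) : dform R k.+1 := fun x v =>
  \sum_(i < k.+1) (-1) ^+ i *
    'D_(v i) (fun y => local (pchart x) a y (fun j => v (lift i j)) : R^o)
             (cfun (pchart x) x).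

Definition extdC (k : nat) (a : dform R[i] k) : dform R[i] k.+1 := fun x v =>
  extd (fun x v => complex.Re (a x v)) x v +i*
  extd (fun x v => complex.Im (a x v)) x v.

Section Matrices.
(* Instantiated below with K = R, isf = is_form, d = extd, and with            *)
(* K = R[i], isf = is_formC, d = extdC.                                        *)
Variables (K : fieldType) (isf : forall k, dform K k -> Prop)
  (d : forall k, dform K k -> dform K k.+1).

Definition mform (k p q : nat) : Type := dform 'M[K]_(p, q) k.

Definition is_mform (k p q : nat) (w : mform k p q) : Prop :=
  forall i j, isf (fun x v => w x v i j).

Definition mextd (k p q : nat) (w : mform k p q) : mform k.+1 p q :=
  fun x v => \matrix_(i, j) d (fun x v => w x v i j) x v.

(* Normalized so that (a /\ b)(u, v) = a(u) b(v) - a(v) b(u) for 1-forms.      *)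
Definition mwedge (k l p q r : nat) (a : mform k p q) (b : mform l q r) :
    mform (k + l) p r := fun x v =>
  ((k`! * l`!)%:R)^-1 *: \sum_(s : 'S_(k + l)) (-1) ^+ s *:
    (a x (fun i => v (s (lshift l i))) *m b x (fun j => v (s (rshift k j)))).

Definition curvature (r : nat) (w : mform 1 r r) : mform 2 r r :=
  fun x v => mextd w x v + mwedge w w x v.

Definition tr_cs (r : nat) (w : mform 1 r r) : dform K 3 := fun x v =>
  \tr (mwedge w (mextd w) x v + (2 / 3) *: mwedge (mwedge w w) w x v).

(* Sections of the product bundle of fibre K^r. *)
Definition is_section (r : nat) (s : X -> 'cV[K]_r) : Prop :=
  is_mform (form0 s).

(* K-linearity on sections is the case of constant f in the Leibniz rule.      *)
Definition is_connection (r : nat)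
    (nabla : (X -> 'cV[K]_r) -> mform 1 r 1) : Prop :=
  [/\ forall s, is_section s -> is_mform (nabla s),
      forall s t, is_section s -> is_section t -> forall x v,
        nabla (fun x => s x + t x) x v = nabla s x v + nabla t x v &
      forall (f : X -> K) s, isf (form0 f) -> is_section s -> forall x v,
        nabla (fun x => f x *: s x) x v =
          d (form0 f) x v *: s x + f x *: nabla s x v].

(* nabla = d + w *)
Definition connection_form (r : nat)
    (nabla : (X -> 'cV[K]_r) -> mform 1 r 1) (w : mform 1 r r) : Prop :=
  forall s, is_section s -> forall x v,
    nabla s x v = mextd (form0 s) x v + w x v *m s x.

Definition Pi1 (r1 r2 : nat) : 'M[K]_(r1 + r2) := block_mx 1%:M 0 0 0.
Definition Pi2 (r1 r2 : nat) : 'M[K]_(r1 + r2) := block_mx 0 0 0 1%:M.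

(* Pi_i nabla Pi_i = nabla_i, where E_1 and E_2 sit inside E as the column     *)
(* vectors col_mx s 0 and col_mx 0 s.                                          *)
Definition extends (r1 r2 : nat)
    (nabla : (X -> 'cV[K]_(r1 + r2)) -> mform 1 (r1 + r2) 1)
    (nabla1 : (X -> 'cV[K]_r1) -> mform 1 r1 1)
    (nabla2 : (X -> 'cV[K]_r2) -> mform 1 r2 1) : Prop :=
  (forall s, is_section s -> forall x v,
     Pi1 r1 r2 *m nabla (fun x => Pi1 r1 r2 *m col_mx (s x) 0) x v =
       col_mx (nabla1 s x v) 0) /\
  (forall s, is_section s -> forall x v,
     Pi2 r1 r2 *m nabla (fun x => Pi2 r1 r2 *m col_mx 0 (s x)) x v =
       col_mx 0 (nabla2 s x v)).

Definition block_form (k r1 r2 : nat) (w1 : mform k r1 r1)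
    (a : mform k r1 r2) (b : mform k r2 r1) (w2 : mform k r2 r2) :
    mform k (r1 + r2) (r1 + r2) :=
  fun x v => block_mx (w1 x v) (a x v) (b x v) (w2 x v).

End Matrices.

Definition cs (r : nat) (w : mform R 1 r r) : dform R 3 := fun x v =>
  - (16 * pi ^+ 2)^-1 * tr_cs extd w x v.

Definition csC (r : nat) (w : mform R[i] 1 r r) : dform R[i] 3 := fun x v =>
  (- (8 * pi ^+ 2)^-1)%:C * tr_cs extdC w x v.

End Forms.

(* Main.v *)
Require Import Defs.
From HB Require Import structures.
From mathcomp Require Import all_boot all_order all_algebra all_fingroup.
From mathcomp Require Import all_classical all_reals all_analysis.
From mathcomp Require Import complex.
From mathcomp Require Import ring.
Set Implicit Arguments.
Unset Strict Implicit.
Unset Printing Implicit Defensive.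
Import Order.TTheory GRing.Theory Num.Theory.
Import numFieldNormedType.Exports.
Local Open Scope ring_scope.
Local Open Scope complex_scope.

(** The identity is pointwise algebra in the blocks of [w].  Since
    R12 = dA + w1 A + A w2 and R21 = dB + B w1 + w2 B vanish,

      tr (A dB) = - tr (A B w1) - tr (A w2 B),
      tr (B dA) = - tr (B w1 A) - tr (B A w2).

    The trace of a product of three 1-forms is invariant under cyclic
    permutation of the factors (a 3-cycle is even), so these two terms add up
    to - 2 tr (A B w1) - 2 tr (B A w2).  Expanding the cube gives

      tr w^3 = tr w1^3 + tr w2^3 + 3 tr (A B w1) + 3 tr (B A w2),

    and the factor 2/3 turns the mixed terms of the cube into exactly the
    opposite of those of tr (w dw).

    Associativity and cyclicity both come from writing either bracketing of a
    triple product as one alternating sum over 'S_3 ([mwedge_mwedge_l],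
    [mwedge_mwedge_r], [mxtrace_triple_cycle]).  The exterior derivative enters
    through its entrywise action on matrices ([mextd_block]), which has the
    same form for real and complex entries, so a single computation
    ([tr_cs_block]) serves both kinds of bundles. *)

Section WedgeAlgebra.
Context {R : realType} {n : nat} (X : manifold R n) (K : numFieldType).

Local Notation mform := (mform X K).

(** * Bilinearity and block matrices *)

Definition madd k p q (a b : mform k p q) : mform k p q :=
  fun x v => a x v + b x v.

Definition mopp k p q (a : mform k p q) : mform k p q := fun x v => - a x v.

Lemma mwedgeDr k l p q r (a : mform k p q) (b c : mform l q r) x v :
  mwedge a (madd b c) x v = mwedge a b x v + mwedge a c x v.
Proof.
rewrite /mwedge -scalerDr -big_split; congr (_ *: _).
by apply: eq_bigr => s _; rewrite mulmxDr scalerDr.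
Qed.

Lemma mwedgeDl k l p q r (a b : mform k p q) (c : mform l q r) x v :
  mwedge (madd a b) c x v = mwedge a c x v + mwedge b c x v.
Proof.
rewrite /mwedge -scalerDr -big_split; congr (_ *: _).
by apply: eq_bigr => s _; rewrite mulmxDl scalerDr.
Qed.

Lemma mwedgeNr k l p q r (a : mform k p q) (b : mform l q r) x v :
  mwedge a (mopp b) x v = - mwedge a b x v.
Proof.
rewrite /mwedge -scalerN -sumrN; congr (_ *: _).
by apply: eq_bigr => s _; rewrite mulmxN scalerN.
Qed.

Lemma mwedge_block k l r1 r2
    (a : mform k r1 r1) (b : mform k r1 r2)
    (c : mform k r2 r1) (e : mform k r2 r2)
    (a' : mform l r1 r1) (b' : mform l r1 r2)
    (c' : mform l r2 r1) (e' : mform l r2 r2) :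
  mwedge (block_form a b c e) (block_form a' b' c' e') =
  block_form (madd (mwedge a a') (mwedge b c')) (madd (mwedge a b') (mwedge b e'))
             (madd (mwedge c a') (mwedge e c')) (madd (mwedge c b') (mwedge e e')).
Proof.
apply/funext => x; apply/funext => v.
rewrite /block_form /madd /mwedge -!scalerDr -scale_block_mx -!big_split /=.
congr (_ *: _).
have sum_block (I : Type) (r : seq I) (F1 : I -> 'M[K]_(r1, r1)) F2 F3
    (F4 : I -> 'M[K]_(r2, r2)) :
    \sum_(i <- r) block_mx (F1 i) (F2 i) (F3 i) (F4 i) =
    block_mx (\sum_(i <- r) F1 i) (\sum_(i <- r) F2 i)
             (\sum_(i <- r) F3 i) (\sum_(i <- r) F4 i).
  elim: r => [|i r IHr]; first by rewrite !big_nil block_mx0.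
  by rewrite !big_cons IHr add_block_mx.
rewrite -sum_block; apply: eq_bigr => s _.
by rewrite mulmx_block scale_block_mx !scalerDr.
Qed.

(** An arbitrary operator [d] on scalar forms is allowed because [mextd]
    applies it to each entry separately, and each entry of a block matrix
    form is an entry of one of its blocks. *)
Lemma mextd_block (d : forall k, dform X K k -> dform X K k.+1) k r1 r2
    (a : mform k r1 r1) (b : mform k r1 r2)
    (c : mform k r2 r1) (e : mform k r2 r2) :
  mextd d (block_form a b c e) =
  block_form (mextd d a) (mextd d b) (mextd d c) (mextd d e).
Proof.
apply/funext => x; apply/funext => v; apply/matrixP => i j.
rewrite mxE /block_form.
case: (split_ordP i) => i' ->; case: (split_ordP j) => j' ->;
  rewrite ?(block_mxEul, block_mxEur, block_mxEdl, block_mxEdr) mxE;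
  congr (d k _ x v); apply/funext => y; apply/funext => u;
  by rewrite ?(block_mxEul, block_mxEur, block_mxEdl, block_mxEdr).
Qed.

(** * Triple products of 1-forms *)

Lemma sum_S2 (V : zmodType) (F : 'S_2 -> V) :
  \sum_s F s = F 1%g + F (tperm 0 1).
Proof.
rewrite (bigD1 1%g) //= (bigD1 (tperm 0 1)) /=; last first.
  by apply/eqP => /permP/(_ 0); rewrite tpermL perm1.
rewrite big1 ?addr0 // => s /andP[s1 st].
have ord2 (i : 'I_2) : i = 0 \/ i = 1.
  by case: i => [[|[|//]]] ?; [left|right]; apply/val_inj.
have s01 : s 0 != s 1 by rewrite (inj_eq perm_inj).
case: (ord2 (s 0)) => e0; case: (ord2 (s 1)) => e1.
- by rewrite e0 e1 in s01.
- by case/eqP: s1; apply/permP => i; case: (ord2 i) => ->; rewrite perm1.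
- by case/eqP: st; apply/permP => i; case: (ord2 i) => ->; rewrite ?tpermL ?tpermR.
- by rewrite e0 e1 in s01.
Qed.

Lemma mwedge11E p q r (a : mform 1 p q) (b : mform 1 q r) x v :
  mwedge a b x v = a x (fun=> v 0) *m b x (fun=> v 1)
                 - a x (fun=> v 1) *m b x (fun=> v 0).
Proof.
rewrite /mwedge (_ : (1`! * 1`!)%N = 1%N) // invr1 scale1r sum_S2.
rewrite odd_perm1 odd_tperm expr0 expr1 scale1r scaleN1r.
have vE (i : 'I_2) (f : 'I_1 -> 'I_2) (s : 'S_2) : f 0 = i ->
    (fun j => v (s (f j))) = (fun=> v (s i)).
  by move=> <-; apply/funext => j; rewrite ord1.
rewrite !(vE 0 (@lshift 1 1)) ?(vE 1 (@rshift 1 1)) ?perm1 ?tpermL ?tpermR //;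
  by apply/val_inj.
Qed.

(** The common value of the two bracketings of a triple wedge product.  The
    normalizing factors cancel, which makes it the convenient form for
    permuting the factors. *)
Definition triple p q r t (a : mform 1 p q) (b : mform 1 q r) (c : mform 1 r t)
    : mform 3 p t := fun x v =>
  \sum_(s : 'S_3) (-1) ^+ s *:
    (a x (fun=> v (s 0)) *m b x (fun=> v (s 1)) *m c x (fun=> v (s 2))).

(** Precomposing the permutations with a transposition of two factors of an
    alternating sum changes its sign, so antisymmetrizing those two
    factors beforehand doubles it; this is the factor k! l! = 2 by which the wedge
    product of a 1-form and a 2-form is normalized. *)
Lemma alternate_S3 (V : lmodType K) (F : 'S_3 -> V) (i j : 'I_3) : i != j ->
  \sum_(s : 'S_3) (-1) ^+ s *: (F s - F (tperm i j * s)%g) =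
  2%:R *: \sum_(s : 'S_3) (-1) ^+ s *: F s.
Proof.
move=> ij; under eq_bigr do rewrite scalerBr.
rewrite sumrB scaler_nat mulr2n; congr (_ + _).
rewrite [in RHS](reindex_inj (mulgI (tperm i j))) -sumrN /=.
by apply: eq_bigr => s _; rewrite odd_permM odd_tperm ij signr_addb mulN1r scaleNr.
Qed.

Lemma mwedge_mwedge_l p q r t
    (a : mform 1 p q) (b : mform 1 q r) (c : mform 1 r t) :
  mwedge (mwedge a b) c = triple a b c.
Proof.
apply/funext => x; apply/funext => v.
pose F (s : 'S_3) :=
  a x (fun=> v (s 0)) *m b x (fun=> v (s 1)) *m c x (fun=> v (s 2)).
rewrite {1}/mwedge -[X in _ *: X]/(\sum_(s : 'S_3) _).
transitivity ((2%:R)^-1 *: \sum_(s : 'S_3) (-1) ^+ s *: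
    (F s - F (tperm 0 1%R * s)%g)).
  congr (_ *: _); apply: eq_bigr => s _; congr (_ *: _).
  rewrite mwedge11E mulmxBl /F !permM tpermL tpermR tpermD //.
  have -> : lshift 1 (0 : 'I_2) = 0 :> 'I_3 by apply/val_inj.
  have -> : lshift 1 (1 : 'I_2) = 1 :> 'I_3 by apply/val_inj.
  have -> : (fun i => v (s (rshift 2 i))) = (fun=> v (s 2)).
    by apply/funext => i; congr (v (s _)); apply/val_inj; rewrite /= ord1.
  by [].
by rewrite alternate_S3 // scalerA mulVf ?pnatr_eq0 // scale1r.
Qed.

Lemma mwedge_mwedge_r p q r t
    (a : mform 1 p q) (b : mform 1 q r) (c : mform 1 r t) :
  mwedge a (mwedge b c) = triple a b c.
Proof.
apply/funext => x; apply/funext => v.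
pose F (s : 'S_3) :=
  a x (fun=> v (s 0)) *m b x (fun=> v (s 1)) *m c x (fun=> v (s 2)).
rewrite {1}/mwedge -[X in _ *: X]/(\sum_(s : 'S_3) _).
transitivity ((2%:R)^-1 *: \sum_(s : 'S_3) (-1) ^+ s *:
    (F s - F (tperm 1%R 2 * s)%g)).
  congr (_ *: _); apply: eq_bigr => s _; congr (_ *: _).
  rewrite mwedge11E mulmxBr !mulmxA /F !permM tpermL tpermR.
  rewrite tpermD //.
  have -> : rshift 1 (0 : 'I_2) = 1 :> 'I_3 by apply/val_inj.
  have -> : rshift 1 (1 : 'I_2) = 2 :> 'I_3 by apply/val_inj.
  have -> : (fun i : 'I_1 => v (s (lshift 2 i))) = (fun=> v (s 0)).
    by apply/funext => i; congr (v (s _)); apply/val_inj; rewrite /= ord1.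
  by [].
by rewrite alternate_S3 // scalerA mulVf ?pnatr_eq0 // scale1r.
Qed.

(** A cyclic shift of the three factors is an even permutation, so no sign
    appears. *)
Lemma mxtrace_triple_cycle p q r
    (a : mform 1 p q) (b : mform 1 q r) (c : mform 1 r p) x v :
  \tr (triple a b c x v) = \tr (triple b c a x v).
Proof.
rewrite /triple (reindex_inj (mulgI (tperm 0 1%R * tperm 1%R 2)%g)) !raddf_sum /=.
apply: eq_bigr => s _; rewrite !mxtraceZ !odd_permM !odd_tperm /=.
rewrite !permM !tpermL tpermR (@tpermD _ 0 1 2) // tpermR.
by rewrite (@tpermD _ 1 2 0) // -mulmxA mxtrace_mulC.
Qed.

(** * The Chern-Simons trace of a block connection form *)

Lemma curvature_block (d : forall k, dform X K k -> dform X K k.+1) r1 r2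
    (w1 : mform 1 r1 r1) (A : mform 1 r1 r2)
    (B : mform 1 r2 r1) (w2 : mform 1 r2 r2) :
  curvature d (block_form w1 A B w2) =
  block_form (madd (curvature d w1) (mwedge A B))
             (madd (mextd d A) (madd (mwedge w1 A) (mwedge A w2)))
             (madd (mextd d B) (madd (mwedge B w1) (mwedge w2 B)))
             (madd (mwedge B A) (curvature d w2)).
Proof.
apply/funext => x; apply/funext => v.
rewrite /curvature mextd_block mwedge_block /block_form /madd add_block_mx.
by congr block_mx; [rewrite addrA | rewrite addrCA].
Qed.

Lemma Pi1_block_Pi2 r1 r2 (M11 : 'M[K]_r1) (M12 : 'M[K]_(r1, r2))
    (M21 : 'M[K]_(r2, r1)) (M22 : 'M[K]_r2) :
  Pi1 K r1 r2 *m block_mx M11 M12 M21 M22 *m Pi2 K r1 r2 = block_mx 0 M12 0 0.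
Proof.
by rewrite /Pi1 /Pi2 !mulmx_block !(mul0mx, mulmx0, mul1mx, mulmx1, addr0, add0r).
Qed.

Lemma Pi2_block_Pi1 r1 r2 (M11 : 'M[K]_r1) (M12 : 'M[K]_(r1, r2))
    (M21 : 'M[K]_(r2, r1)) (M22 : 'M[K]_r2) :
  Pi2 K r1 r2 *m block_mx M11 M12 M21 M22 *m Pi1 K r1 r2 = block_mx 0 0 M21 0.
Proof.
by rewrite /Pi1 /Pi2 !mulmx_block !(mul0mx, mulmx0, mul1mx, mulmx1, addr0, add0r).
Qed.

(** The vanishing of the off-diagonal curvature expresses dA and dB as wedge
    products, so that [d] survives only in w1 dw1 and w2 dw2; what remains is
    a linear identity between traces of triple products. *)
Lemma tr_cs_block (d : forall k, dform X K k -> dform X K k.+1) r1 r2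
    (w1 : mform 1 r1 r1) (A : mform 1 r1 r2)
    (B : mform 1 r2 r1) (w2 : mform 1 r2 r2) :
  (forall x v, Pi1 K r1 r2 *m curvature d (block_form w1 A B w2) x v
                 *m Pi2 K r1 r2 = 0) ->
  (forall x v, Pi2 K r1 r2 *m curvature d (block_form w1 A B w2) x v
                 *m Pi1 K r1 r2 = 0) ->
  forall x v, tr_cs d (block_form w1 A B w2) x v = tr_cs d w1 x v + tr_cs d w2 x v.
Proof.
rewrite curvature_block => R12 R21 x v.
have dA : mextd d A = mopp (madd (mwedge w1 A) (mwedge A w2)).
  apply/funext => y; apply/funext => u; apply/eqP; rewrite -addr_eq0.
  have := R12 y u; rewrite Pi1_block_Pi2 -[RHS]block_mx0.
  by case/eq_block_mx => _ /eqP.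
have dB : mextd d B = mopp (madd (mwedge B w1) (mwedge w2 B)).
  apply/funext => y; apply/funext => u; apply/eqP; rewrite -addr_eq0.
  have := R21 y u; rewrite Pi2_block_Pi1 -[RHS]block_mx0.
  by case/eq_block_mx => _ _ /eqP.
rewrite /tr_cs mextd_block !mwedge_block dA dB /block_form.
rewrite scale_block_mx add_block_mx mxtrace_block /madd.
(* The sums inside a wedge product are folded back, as bilinearity applies to
   them; the outer ones stay sums of matrices, to which the trace applies. *)
rewrite -/(madd (mwedge B w1) (mwedge w2 B)) -/(madd (mwedge w1 A) (mwedge A w2)).
rewrite !(mwedgeNr, mwedgeDr, mwedgeDl) !(mwedge_mwedge_l, mwedge_mwedge_r).
rewrite !(mxtraceD, mxtraceZ (2 / 3), raddfN) /= !mxtraceD.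
(* Each mixed trace is tr (A B w1) or tr (B A w2) up to a cyclic shift. *)
rewrite (mxtrace_triple_cycle B w1 A) (mxtrace_triple_cycle w1 A B).
rewrite (mxtrace_triple_cycle A w2 B) (mxtrace_triple_cycle w2 B A).
by field; rewrite ?pnatr_eq0.
Qed.

End WedgeAlgebra.

Theorem lemma5 (R : realType) (n : nat) (X : manifold R n) (r1 r2 : nat) :
  (* real bundles *)
  (forall (nabla1 : (X -> 'cV[R]_r1) -> mform X R 1 r1 1)
          (nabla2 : (X -> 'cV[R]_r2) -> mform X R 1 r2 1)
          (nabla : (X -> 'cV[R]_(r1 + r2)) -> mform X R 1 (r1 + r2) 1)
          (w1 : mform X R 1 r1 r1) (w2 : mform X R 1 r2 r2)
          (A : mform X R 1 r1 r2) (B : mform X R 1 r2 r1)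
          (w : mform X R 1 (r1 + r2) (r1 + r2)),
     is_connection (@is_form R n X) (@extd R n X) nabla1 ->
     is_connection (@is_form R n X) (@extd R n X) nabla2 ->
     is_connection (@is_form R n X) (@extd R n X) nabla ->
     extends (@is_form R n X) nabla nabla1 nabla2 ->
     is_mform (@is_form R n X) w1 -> is_mform (@is_form R n X) w2 ->
     is_mform (@is_form R n X) A -> is_mform (@is_form R n X) B ->
     connection_form (@is_form R n X) (@extd R n X) nabla1 w1 ->
     connection_form (@is_form R n X) (@extd R n X) nabla2 w2 ->
     connection_form (@is_form R n X) (@extd R n X) nabla w ->
     w = block_form w1 A B w2 ->
     (forall x v,
        Pi1 R r1 r2 *m curvature (@extd R n X) w x v *m Pi2 R r1 r2 = 0) ->
     (forall x v,
        Pi2 R r1 r2 *m curvature (@extd R n X) w x v *m Pi1 R r1 r2 = 0) ->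
     forall x v, cs w x v = cs w1 x v + cs w2 x v) /\
  (* complex bundles *)
  (forall (nabla1 : (X -> 'cV[R[i]]_r1) -> mform X R[i] 1 r1 1)
          (nabla2 : (X -> 'cV[R[i]]_r2) -> mform X R[i] 1 r2 1)
          (nabla : (X -> 'cV[R[i]]_(r1 + r2)) -> mform X R[i] 1 (r1 + r2) 1)
          (w1 : mform X R[i] 1 r1 r1) (w2 : mform X R[i] 1 r2 r2)
          (A : mform X R[i] 1 r1 r2) (B : mform X R[i] 1 r2 r1)
          (w : mform X R[i] 1 (r1 + r2) (r1 + r2)),
     is_connection (@is_formC R n X) (@extdC R n X) nabla1 ->
     is_connection (@is_formC R n X) (@extdC R n X) nabla2 ->
     is_connection (@is_formC R n X) (@extdC R n X) nabla ->
     extends (@is_formC R n X) nabla nabla1 nabla2 ->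
     is_mform (@is_formC R n X) w1 -> is_mform (@is_formC R n X) w2 ->
     is_mform (@is_formC R n X) A -> is_mform (@is_formC R n X) B ->
     connection_form (@is_formC R n X) (@extdC R n X) nabla1 w1 ->
     connection_form (@is_formC R n X) (@extdC R n X) nabla2 w2 ->
     connection_form (@is_formC R n X) (@extdC R n X) nabla w ->
     w = block_form w1 A B w2 ->
     (forall x v,
        Pi1 R[i] r1 r2 *m curvature (@extdC R n X) w x v *m Pi2 R[i] r1 r2 = 0) ->
     (forall x v,
        Pi2 R[i] r1 r2 *m curvature (@extdC R n X) w x v *m Pi1 R[i] r1 r2 = 0) ->
     forall x v, csC w x v = csC w1 x v + csC w2 x v).
Proof.
split=> nabla1 nabla2 nabla w1 w2 A B w _ _ _ _ _ _ _ _ _ _ _ -> R12 R21 x v.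
- by rewrite /cs (tr_cs_block R12 R21) mulrDr.
- by rewrite /csC (tr_cs_block R12 R21) mulrDr.
Qed.
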